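(* Let $m\geq 3$ and $n\geq 3$ be integers. The number of crossing tiles on an $(m,n)$-mosaic made of corner connection tiles is bounded above by: (a) $mn/2$, if $m$ and $n$ are even; (b) $(mn+n-4)/2$, if $m$ and $n$ are odd and $m\leq n$, or if $m$ is odd and $n$ is even.
   Context: Corner connection tiles are unit square tiles, each of which is either blank or contains a piece of a knot diagram whose endpoints (connection points) are at corners of the square. There are eleven tiles $T_0,\dots,T_{10}$: the blank tile $T_0$; four single-arc tiles $T_1,\dots,T_4$, each containing one arc joining the two endpoints of one of the four sides of the tile; two diagonal line segment tiles $T_5,T_6$, each containing one diagonal of the square; two double-arc tiles $T_7,T_8$, each containing two disjoint arcs, joining the four corners in pairs along two opposite sides (one tile for each of the two pairs of opposite sides); and two crossing tiles $T_9,T_{10}$, each containing both diagonals meeting in one crossing (one tile for each choice of over-strand). An $(m,n)$-mosaic made of corner connection tiles is an array of such tiles with $m$ rows and $n$ columns that is suitably connected, i.e. each connection point of a tile meets a connection point of an adjacent tile (sharing a side or a corner), and that depicts a knot or link diagram; thus at each corner point of the array that is a connection point of some tile, exactly two tiles have a connection point there. *)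

(* Defs.v *)
From mathcomp Require Import all_boot matrix.

Set Implicit Arguments.
Unset Strict Implicit.
Unset Printing Implicit Defensive.

(* A corner of a unit tile, as (row offset, column offset) from its top-left
   corner: rows are numbered downwards and columns to the right. *)
Definition corner : Type := (bool * bool)%type.

Definition NW : corner := (false, false).
Definition NE : corner := (false, true).
Definition SW : corner := (true, false).
Definition SE : corner := (true, true).

Inductive tile : Type :=
  T0 | T1 | T2 | T3 | T4 | T5 | T6 | T7 | T8 | T9 | T10.

(* The strands drawn on a tile, each given by its two end corners.  T9 and T10
   carry the same two diagonals; the over-strand is NW-SE on T9 and NE-SW on
   T10. *)
Definition strands (t : tile) : seq (corner * corner) :=
  match t with
  | T0 => [::]
  | T1 => [:: (NW, NE)]
  | T2 => [:: (NE, SE)]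
  | T3 => [:: (SW, SE)]
  | T4 => [:: (NW, SW)]
  | T5 => [:: (NW, SE)]
  | T6 => [:: (NE, SW)]
  | T7 => [:: (NW, NE); (SW, SE)]
  | T8 => [:: (NW, SW); (NE, SE)]
  | T9 | T10 => [:: (NW, SE); (NE, SW)]
  end.

Definition connection_point (t : tile) (c : corner) : bool :=
  has (fun s => (c == s.1) || (c == s.2)) (strands t).

Definition crossing_tile (t : tile) : bool :=
  match t with T9 | T10 => true | _ => false end.

Section Mosaic.

Variables m n : nat.

(* The corner points of an m x n array are the pairs (i, j) with i <= m and
   j <= n; neighbouring tiles share them. *)
Definition corner_point (p : 'I_m * 'I_n) (c : corner) : nat * nat :=
  (p.1 + c.1, p.2 + c.2).

Definition connects_at (M : 'M[tile]_(m, n)) (p : 'I_m * 'I_n)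
    (v : nat * nat) : bool :=
  [exists c : corner,
     connection_point (M p.1 p.2) c && (corner_point p c == v)].

(* Two distinct tiles with a common corner point share a side or a corner, so
   adjacency of p and q need not be required separately. *)
Definition suitably_connected (M : 'M[tile]_(m, n)) : Prop :=
  forall (p : 'I_m * 'I_n) (v : nat * nat), connects_at M p v ->
    exists2 q : 'I_m * 'I_n, q != p & connects_at M q v.

(* Strands meet only at crossings inside tiles and end only at corner points,
   at most one per tile and corner.  So the strands form closed curves, i.e. a
   link diagram, exactly when every connection point joins two tiles. *)
Definition depicts_link (M : 'M[tile]_(m, n)) : Prop :=
  forall (p : 'I_m * 'I_n) (v : nat * nat), connects_at M p v ->
    #|[set q : 'I_m * 'I_n | connects_at M q v]| = 2.

Definition is_mosaic (M : 'M[tile]_(m, n)) : Prop :=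
  suitably_connected M /\ depicts_link M.

Definition num_crossing_tiles (M : 'M[tile]_(m, n)) : nat :=
  #|[set p : 'I_m * 'I_n | crossing_tile (M p.1 p.2)]|.

End Mosaic.

(* Main.v *)
Require Import Defs.
From mathcomp Require Import all_boot matrix zify.

(** The four tiles around an interior corner point [v] of the array all touch
    [v], and a crossing tile has connection points at all four of its corners.
    As exactly two tiles connect at a connection point, every 2 x 2 block of
    tiles contains at most two crossing tiles ([crossings_in_block]).  Besides,
    a corner point of the whole array belongs to a single tile, so nothing can
    connect there and the four corner tiles are not crossing tiles
    ([array_corner_no_connection]).  The bounds follow from these two facts by a
    covering argument on a 0/1 array [f] in which every 2 x 2 block has sum at
    most 2.

    If [m] and [n] are even, the array is tiled by 2 x 2 blocks, which gives
    [m n / 2].  If [m] is odd and [n] even, all rows but the last are tiled by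
    blocks and the last row, whose two ends vanish, has sum at most [n - 2];
    the total is [(m - 1) n / 2 + n - 2 = (m n + n - 4) / 2].

    If both are odd and [m <= n], blocks along the rows would waste a column,
    so the leading [m x m] square is peeled from its bottom right corner by L
    shapes of width 2.  Such a shape is covered by 2 x 2 blocks, except for the
    single diagonal cell at its bend ([square_sum_step]).  Hence the
    square costs at most [m (m + 1) / 2], where the diagonal cells of even index
    (counting from 0) count 1 each.  The remaining [n - m] columns cost a
    tiling by blocks plus the cells of the last row.  The single cells include
    both [(0, 0)] and [(m - 1, n - 1)], which vanish, and this saves 2 from
    [n (m + 1) / 2]. *)

Set Implicit Arguments.
Unset Strict Implicit.
Unset Printing Implicit Defensive.

(** * Arrays whose 2 x 2 blocks have sum at most 2 *)

Definition block_bounded (f : nat -> nat -> bool) : Prop :=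
  forall i j, f i j + f i j.+1 + f i.+1 j + f i.+1 j.+1 <= 2.

Definition box_sum (f : nat -> nat -> bool) (r r' c c' : nat) : nat :=
  \sum_(r <= i < r') \sum_(c <= j < c') f i j.

Section BoxSums.

Variable f : nat -> nat -> bool.

Lemma box_sum_cat_rows r s r' c c' : r <= s -> s <= r' ->
  box_sum f r r' c c' = box_sum f r s c c' + box_sum f s r' c c'.
Proof. by move=> rs sr'; rewrite /box_sum (big_cat_nat rs sr'). Qed.

Lemma box_sum_cat_cols r r' c d c' : c <= d -> d <= c' ->
  box_sum f r r' c c' = box_sum f r r' c d + box_sum f r r' d c'.
Proof.
move=> cd dc'; rewrite /box_sum -big_split /=.
by apply: eq_bigr => i _; rewrite (big_cat_nat cd dc').
Qed.

Lemma box_sum_row r c c' : box_sum f r r.+1 c c' = \sum_(c <= j < c') f r j.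
Proof. by rewrite /box_sum big_nat1. Qed.

Lemma box_sum_cell r c : box_sum f r r.+1 c c.+1 = f r c.
Proof. by rewrite box_sum_row big_nat1. Qed.

Lemma row_sum_le r c c' : \sum_(c <= j < c') f r j <= c' - c.
Proof.
rewrite -[leqRHS]muln1 -sum_nat_const_nat.
by apply: leq_sum => j _; apply: leq_b1.
Qed.

Lemma row_sum_last0 r c w : f r (c + w) = false ->
  \sum_(c <= j < (c + w).+1) f r j <= w.
Proof.
move=> f0; rewrite big_nat_recr ?leq_addr //= f0 addn0.
by have := row_sum_le r c (c + w); rewrite addKn.
Qed.

Hypothesis f_bounded : block_bounded f.

Lemma block_sum_le r c : box_sum f r r.+2 c c.+2 <= 2.
Proof.
have := f_bounded r c.
rewrite (@box_sum_cat_rows _ r.+1) // !(@box_sum_cat_cols _ _ c c.+1 c.+2) //.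
by rewrite !box_sum_cell addnA.
Qed.

Lemma even_strip_sum_le r c b : box_sum f r r.+2 c (c + b.*2) <= b.*2.
Proof.
elim: b => [|b IHb]; first by rewrite addn0 /box_sum big1 // => i _; rewrite big_geq.
rewrite (@box_sum_cat_cols _ _ _ (c + b.*2)); [|lia..].
by rewrite doubleS !addnS; have := block_sum_le r (c + b.*2); lia.
Qed.

Lemma even_box_sum_le r a c b :
  box_sum f r (r + a.*2) c (c + b.*2) <= a * b.*2.
Proof.
elim: a => [|a IHa]; first by rewrite addn0 /box_sum big_geq.
rewrite (@box_sum_cat_rows _ (r + a.*2)); [|lia..].
by rewrite doubleS !addnS mulSn; have := even_strip_sum_le (r + a.*2) c b; lia.
Qed.

(** The L shape added here is covered by its two arms of width 2, both
    containing the diagonal cell of index [k.*2.+1] (it is counted twice, which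
    is harmless for an upper bound), and by the bend.  Extending each arm over
    this cell makes its length even. *)
Lemma square_sum_step k :
  box_sum f 0 k.*2.+3 0 k.*2.+3 <=
  box_sum f 0 k.*2.+1 0 k.*2.+1 + (k.+1).*2.*2 + f k.*2.+2 k.*2.+2.
Proof.
have := even_strip_sum_le k.*2.+1 0 k.+1.
have := even_box_sum_le 0 k.+1 k.*2.+1 1.
rewrite (_ : k.+1 * 1.*2 = (k.+1).*2) ?muln2 // !add0n doubleS addn2.
move: k.*2.+1 => s.
rewrite !(@box_sum_cat_rows 0 s s.+2) ?(@box_sum_cat_rows 0 s s.+1) //; try lia.
rewrite !(@box_sum_cat_cols _ _ 0 s s.+2) //; try lia.
rewrite !(@box_sum_cat_cols _ _ 0 s s.+1) //; try lia.
rewrite !(@box_sum_cat_rows s s.+1 s.+2) // !(@box_sum_cat_cols _ _ s s.+1 s.+2) //.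
by rewrite !box_sum_cell; lia.
Qed.

Lemma odd_square_sum_le k : f 0 0 = false ->
  box_sum f 0 k.*2.+1 0 k.*2.+1 <= k * k.*2.+3.
Proof.
move=> f00; elim: k => [|k IHk]; first by rewrite box_sum_cell f00.
rewrite doubleS; apply: leq_trans (square_sum_step k) _.
by have := leq_b1 (f k.*2.+2 k.*2.+2); nia.
Qed.

Lemma even_cols_box_sum_le a b :
    f a.*2 0 = false -> f a.*2 b.*2.+1 = false ->
  box_sum f 0 a.*2.+1 0 b.*2.+2 <= a * b.*2.+2 + b.*2.
Proof.
move=> f_first f_last; rewrite (@box_sum_cat_rows _ a.*2) //.
apply: leq_add; first by have := even_box_sum_le 0 a 0 b.+1; rewrite !add0n.
rewrite box_sum_row big_nat_recl // f_first add0n.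
rewrite -(big_add1 _ _ 0 b.*2.+2 xpredT (fun j => nat_of_bool (f a.*2 j))).
exact: (@row_sum_last0 _ 1).
Qed.

Lemma odd_box_sum_le k d : 0 < k ->
    f 0 0 = false -> f k.*2 (k.*2 + d.*2) = false ->
  box_sum f 0 k.*2.+1 0 (k.*2 + d.*2).+1 <= k * k.*2.+3 + k * d.*2 + d.*2 - 1.
Proof.
case: d => [|d] k_gt0 f00 f_last.
  (* The last corner is the bend of the outermost L shape. *)
  rewrite addn0 in f_last *.
  case: k k_gt0 f_last => // k _ f_last.
  have := square_sum_step k; rewrite -doubleS f_last.
  by have := odd_square_sum_le k f00; nia.
(* The last corner lies in the last row of the columns beyond the square. *)
rewrite (@box_sum_cat_cols _ _ _ k.*2.+1) //; last by lia.
rewrite (@box_sum_cat_rows _ k.*2 _ k.*2.+1) // box_sum_row.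
have := odd_square_sum_le k f00.
have := even_box_sum_le 0 k k.*2.+1 d.+1.
rewrite add0n addSn.
have := @row_sum_last0 k.*2 k.*2.+1 d.*2.+1.
by rewrite addSnnS -doubleS f_last; lia.
Qed.

End BoxSums.

(** * Crossing tiles of a mosaic *)

Section Crossings.

Variables m n : nat.
Variable M : 'M[tile]_(m, n).

(** Indexing tiles by natural numbers, with no crossing outside the array,
    lets blocks and boxes be written without bounds on their indices. *)
Definition crossing_at (i j : nat) : bool :=
  [exists p : 'I_m * 'I_n,
     crossing_tile (M p.1 p.2) && ((val p.1, val p.2) == (i, j))].

Lemma crossing_at_ord (i : 'I_m) (j : 'I_n) :
  crossing_at i j = crossing_tile (M i j).
Proof.
apply/existsP/idP => [[[i' j'] /= /andP[Mij /eqP[/val_inj <- /val_inj <-]]] //|Mij].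
by exists (i, j); rewrite Mij eqxx.
Qed.

Lemma num_crossing_tilesE :
  num_crossing_tiles M = box_sum crossing_at 0 m 0 n.
Proof.
rewrite /num_crossing_tiles -sum1_card big_mkcond /= /box_sum big_mkord.
under [RHS]eq_bigr => i _ do rewrite big_mkord.
rewrite pair_big /=; apply: eq_bigr => p _.
by rewrite inE crossing_at_ord; case: crossing_tile.
Qed.

Lemma crossing_connects (p : 'I_m * 'I_n) (c : corner) :
  crossing_tile (M p.1 p.2) -> connects_at M p (corner_point p c).
Proof.
move=> Mp; apply/existsP; exists c; rewrite eqxx andbT.
by case: (M _ _) Mp => //; case: c => [[] []].
Qed.

Lemma connects_at_coords (p : 'I_m * 'I_n) a b : connects_at M p (a, b) ->
  p.1 <= a <= p.1.+1 /\ p.2 <= b <= p.2.+1.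
Proof.
by case/existsP => [[[] []]] /andP[_ /eqP[<- <-]] /=; lia.
Qed.

Lemma array_corner_no_connection (p : 'I_m * 'I_n) a b :
    suitably_connected M ->
    (a == 0) || (a == m) -> (b == 0) || (b == n) ->
  ~~ connects_at M p (a, b).
Proof.
move=> Mconn a_end b_end; apply/negP => pv.
have [q q_neq_p qv] := Mconn p _ pv; case/negP: q_neq_p.
have [pv1 pv2] := connects_at_coords pv; have [qv1 qv2] := connects_at_coords qv.
rewrite -pair_eqE /pair_eq -!val_eqE /=.
by have := ltn_ord p.1; have := ltn_ord p.2; have := ltn_ord q.1;
   have := ltn_ord q.2; lia.
Qed.

Lemma array_corner_not_crossing i j :
    suitably_connected M ->
    (i == 0) || (i.+1 == m) -> (j == 0) || (j.+1 == n) ->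
  crossing_at i j = false.
Proof.
move=> Mconn i_end j_end; apply/negbTE/existsP => [[p /andP[Mp /eqP[pi pj]]]].
have := crossing_connects (i != 0, j != 0) Mp.
apply/negP/array_corner_no_connection => //; rewrite /= ?pi ?pj.
  by case: eqP i_end => [->|_] //=; rewrite addn1 => ->; rewrite orbT.
by case: eqP j_end => [->|_] //=; rewrite addn1 => ->; rewrite orbT.
Qed.

Lemma card_connects_le2 v : depicts_link M ->
  #|[set q : 'I_m * 'I_n | connects_at M q v]| <= 2.
Proof.
move=> Mlink; have [->|[p]] := set_0Vmem [set q | connects_at M q v].
  by rewrite cards0.
by rewrite inE => /Mlink ->.
Qed.

(** All four tiles of the block touch its central corner point, where at most
    two tiles connect. *)
Lemma crossings_in_block : depicts_link M -> block_bounded crossing_at.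
Proof.
move=> Mlink i j.
pose around := [set q | connects_at M q (i.+1, j.+1)].
pose block := [:: (i, j); (i, j.+1); (i.+1, j); (i.+1, j.+1)].
pose crossings := [seq x <- block | crossing_at x.1 x.2].
have crossings_uniq : uniq crossings.
  by rewrite filter_uniq //= !inE !xpair_eqE; lia.
have -> : crossing_at i j + crossing_at i j.+1 + crossing_at i.+1 j
          + crossing_at i.+1 j.+1 = size crossings.
  by rewrite size_filter /= addn0 !addnA.
apply: leq_trans (card_connects_le2 (i.+1, j.+1) Mlink).
rewrite -/around cardE -(size_map (fun q : 'I_m * 'I_n => (val q.1, val q.2))).
apply: uniq_leq_size => // x; rewrite mem_filter => /andP[].
case/existsP => p /andP[Mp /eqP xE] x_block; apply/mapP; exists p.
  rewrite mem_enum inE.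
  (* The central point is the bottom right corner of the top left tile, etc. *)
  have := crossing_connects (x.1 == i, x.2 == j) Mp.
  rewrite /corner_point /=; congr connects_at.
  case: xE => -> ->; move: x_block; rewrite !inE.
  by case: x => a b /=; rewrite !xpair_eqE; case: eqP; case: eqP => //= ? ? ?;
     congr pair; lia.
by rewrite xE -surjective_pairing.
Qed.

End Crossings.

Theorem theorem12 (m n : nat) (hm : 3 <= m) (hn : 3 <= n)
    (M : 'M[tile]_(m, n)) (hM : is_mosaic M) :
  (~~ odd m /\ ~~ odd n -> num_crossing_tiles M <= (m * n) %/ 2) /\
  ((odd m /\ odd n /\ m <= n) \/ (odd m /\ ~~ odd n) ->
     num_crossing_tiles M <= (m * n + n - 4) %/ 2).
Proof.
case: hM => Mconn Mlink; rewrite num_crossing_tilesE.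
have blocks := crossings_in_block Mlink.
have corners i j := @array_corner_not_crossing m n M i j Mconn.
split=> [[m_even n_even]|].
  have := even_box_sum_le blocks 0 m./2 0 n./2.
  by rewrite !add0n !even_halfK // leq_divRL //; nia.
rewrite leq_divRL // => -[[m_odd [n_odd le_mn]]|[m_odd n_even]].
  have [k mE] : exists k, m = k.*2.+1 by exists m./2; lia.
  have [d nE] : exists d, n = (k.*2 + d.*2).+1 by exists (n - m)./2; lia.
  have k_gt0 : 0 < k by lia.
  have first0 : crossing_at M 0 0 = false by exact: corners.
  have last0 : crossing_at M k.*2 (k.*2 + d.*2) = false by apply: corners; lia.
  by have := odd_box_sum_le blocks k_gt0 first0 last0; rewrite -mE -nE; nia.
have [a mE] : exists a, m = a.*2.+1 by exists m./2; lia.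
have [b nE] : exists b, n = b.*2.+2 by exists n./2.-1; lia.
have first0 : crossing_at M a.*2 0 = false by apply: corners; lia.
have last0 : crossing_at M a.*2 b.*2.+1 = false by apply: corners; lia.
by have := even_cols_box_sum_le blocks first0 last0; rewrite -mE -nE; nia.
Qed.
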